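(* Under the setting of the context, consider the relaxed MPC problem $$\hat J_N^*(x;\delta)=\min_{\mathbf u}\sum_{k=0}^{N-1}\hat\ell(x_k,u_k)+x_N^\top Px_N\quad\text{s.t. }x_0=x,\ x_{k+1}=Ax_k+Bu_k,$$ where $P$ is as in the context. Then, independently of the relaxation parameter $\delta>0$ (satisfying the admissibility condition), the feedback $u(k)=\hat u_0^*(x(k))$ asymptotically stabilizes the origin of $x(k+1)=Ax(k)+Bu(k)$ for any initial condition $x(0)\in\mathbb{R}^n$.
   Context: System $x(k+1)=Ax(k)+Bu(k)$, $x\in\mathbb{R}^n$, $u\in\mathbb{R}^m$, $(A,B)$ stabilizable. Polytopes $\mathcal{X}=\{x:C_xx\le d_x\}$, $\mathcal{U}=\{u:C_uu\le d_u\}$ (compact), $d_x,d_u$ entrywise strictly positive; $C^i$ row $i$, $d^i$ entry $i$; $\mathbf 1$ all-ones vector. Stage cost $\ell(x,u)=x^\top Qx+u^\top Ru$, $Q\succeq0$, $R\succ0$; horizon $N\ge1$; $\varepsilon>0$. Quadratic relaxed barrier: $\delta>0$, $\beta_2(z;\delta)=\frac12[(\frac{z-2\delta}{\delta})^2-1]-\ln\delta$, $\hat B(z)=-\ln z$ for $z>\delta$ and $\beta_2(z;\delta)$ for $z\le\delta$. With $z_x^i(x)=-C_x^ix+d_x^i$, $\hat B_x=\sum_i\hat B_{x,i}$ where either $\hat B_{x,i}(x)=\hat B(z_x^i(x))+\ln d_x^i-C_x^ix/d_x^i$ (gradient recentering, set $w_x=0$) or $\hat B_{x,i}(x)=(1+w_x^i)(\hat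 B(z_x^i(x))+\ln d_x^i)$ with $w_x\ge0$, $\sum_i(1+w_x^i)(C_x^i)^\top/d_x^i=0$ (weight recentering); $\hat B_u$ analogously with $w_u$. Admissibility: $\hat B_x(0)=\hat B_u(0)=0$, $\nabla\hat B_x(0)=\nabla\hat B_u(0)=0$. $\hat\ell(x,u)=\ell(x,u)+\varepsilon\hat B_u(u)+\varepsilon\hat B_x(x)$. Terminal matrix: $M_x=\frac{1}{2\delta^2}C_x^\top\mathrm{diag}(\mathbf 1+w_x)C_x$, $M_u=\frac{1}{2\delta^2}C_u^\top\mathrm{diag}(\mathbf 1+w_u)C_u$; $K$ and symmetric positive definite $P$ solve the modified Riccati equation $K=-(R+B^\top PB+\varepsilon M_u)^{-1}B^\top PA$, $P=A_K^\top PA_K+K^\top(R+\varepsilon M_u)K+Q+\varepsilon M_x$ with $A_K=A+BK$. *)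

(* Defs.v *)
From HB Require Import structures.
From mathcomp Require Import all_boot all_order all_algebra.
From mathcomp Require Import all_classical all_reals all_analysis.
Set Implicit Arguments. Unset Strict Implicit. Unset Printing Implicit Defensive.
Import Order.TTheory GRing.Theory Num.Theory.
Import numFieldNormedType.Exports.
Local Open Scope ring_scope.

Section Defs.
Variable R : realType.

Definition leV (p : nat) (a b : 'cV[R]_p) := forall i, a i 0 <= b i 0.

Definition qf (n : nat) (M : 'M[R]_n) (x : 'cV[R]_n) : R := (x^T *m M *m x) 0 0.

Definition symmetric (n : nat) (M : 'M[R]_n) := M^T = M.
Definition psd (n : nat) (M : 'M[R]_n) := symmetric M /\ forall x, 0 <= qf M x.
Definition pd (n : nat) (M : 'M[R]_n) := symmetric M /\ forall x, x != 0 -> 0 < qf M x.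

Definition enorm (n : nat) (x : 'cV[R]_n) : R := Num.sqrt (\sum_i (x i 0) ^+ 2).

Definition converges_to_zero (n : nat) (s : nat -> 'cV[R]_n) :=
  forall e : R, 0 < e -> exists K : nat, forall k, (K <= k)%N -> enorm (s k) < e.

Definition stabilizable (n m : nat) (A : 'M[R]_n) (B : 'M[R]_(n, m)) :=
  exists K : 'M[R]_(m, n), forall x : 'cV[R]_n,
    converges_to_zero (fun k => iter k (fun y => (A + B *m K) *m y) x).

Definition beta2 (delta z : R) : R :=
  2^-1 * (((z - 2 * delta) / delta) ^+ 2 - 1) - ln delta.
Definition Bhat (delta z : R) : R := if delta < z then - ln z else beta2 delta z.

Definition zc (p n : nat) (C : 'M[R]_(p, n)) (d : 'cV[R]_p) (x : 'cV[R]_n) i : R :=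
  - (C *m x) i 0 + d i 0.

(* grad = true : gradient recentering (w must be 0);
   grad = false : weight recentering with weights w *)
Definition barrier_term (p n : nat) (grad : bool) (C : 'M[R]_(p, n)) (d w : 'cV[R]_p)
  (delta : R) (x : 'cV[R]_n) (i : 'I_p) : R :=
  if grad then Bhat delta (zc C d x i) + ln (d i 0) - (C *m x) i 0 / d i 0
  else (1 + w i 0) * (Bhat delta (zc C d x i) + ln (d i 0)).

Definition barrier (p n : nat) (grad : bool) (C : 'M[R]_(p, n)) (d w : 'cV[R]_p)
  (delta : R) (x : 'cV[R]_n) : R := \sum_(i < p) barrier_term grad C d w delta x i.

Definition recentering_ok (p n : nat) (grad : bool) (C : 'M[R]_(p, n)) (d w : 'cV[R]_p) :=
  if grad then w = 0
  else (forall i, 0 <= w i 0) /\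
       \sum_(i < p) ((1 + w i 0) / d i 0) *: (row i C)^T = 0.

(* admissibility: f(0) = 0 and gradient of f at 0 vanishes
   (every directional derivative at 0 is 0) *)
Definition admissible (n : nat) (f : 'cV[R]_n -> R) :=
  f 0 = 0 /\ forall v : 'cV[R]_n, is_derive (0 : R) (1 : R) (fun t : R => f (t *: v)) 0.

Definition Mmat (p n : nat) (delta : R) (C : 'M[R]_(p, n)) (w : 'cV[R]_p) : 'M[R]_n :=
  (2 * delta ^+ 2)^-1 *: (C^T *m diag_mx (const_mx 1 + w)^T *m C).

Fixpoint pstate (n m : nat) (A : 'M[R]_n) (B : 'M[R]_(n, m)) (u : nat -> 'cV[R]_m)
  (x : 'cV[R]_n) (k : nat) : 'cV[R]_n :=
  match k with
  | 0 => x
  | k'.+1 => A *m pstate A B u x k' + B *m u k'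
  end.

Definition closed_loop (n m : nat) (A : 'M[R]_n) (B : 'M[R]_(n, m))
  (kappa : 'cV[R]_n -> 'cV[R]_m) (x0 : 'cV[R]_n) (k : nat) : 'cV[R]_n :=
  iter k (fun x => A *m x + B *m kappa x) x0.

Definition GAS (n : nat) (f : 'cV[R]_n -> nat -> 'cV[R]_n) :=
  (forall e : R, 0 < e -> exists d : R, 0 < d /\
      forall x0, enorm x0 < d -> forall k, enorm (f x0 k) < e) /\
  (forall x0, converges_to_zero (f x0)).

End Defs.

(* Main.v *)
(** Along every line through the origin an admissible barrier is convex, has
    slope 0 at the origin and curvature at most twice the quadratic form of
    [Mmat], so it lies between 0 and that form.  The Riccati equation then makes
    [x^T P x] decrease under [u = K x] by at least the stage cost, and appending
    [K x_N] to a shifted optimal input shows that the optimal value [V] decreases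
    along the closed loop by at least the stage cost.

    Since [Q] is only positive semidefinite, the stage cost does not dominate the
    state.  Put [W = Q + eps Mx], [Rt = Rm + eps Mu], [AK = A + B K].  The Riccati
    equation gives [P = AK^T P A + W], which bounds a state by its successor, its
    input and its stage cost; over the horizon this bounds [|x|] by a function of
    [V x] vanishing at 0, whence stability and boundedness.

    For attractivity, completing the square,
    [qf P (A x + B u) + qf Rt u + qf W x = qf P x + qf S (u - K x)], and summing
    along the bounded trajectory shows that [W x], [u] and [u - K x] tend to 0.  If
    [A + B F] is Schur stable, then [(A + B F)^T P AK = P - W - F^T Rt K], so
    [p = P x] satisfies [p_k = (A + B F)^T p_(k+1) + o(1)]; being bounded, it
    tends to 0. *)
Require Import Defs.
From HB Require Import structures.
From mathcomp Require Import all_boot all_order all_algebra.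
From mathcomp Require Import all_classical all_reals all_analysis.
From mathcomp Require Import ring lra.
Import Order.TTheory GRing.Theory Num.Theory.
Import numFieldNormedType.Exports.
Set Implicit Arguments. Unset Strict Implicit. Unset Printing Implicit Defensive.
Local Open Scope ring_scope.

(** * The relaxed logarithm *)

Section TangentInequalities.
Variable R : realType.
Implicit Types (F f : R -> R) (a b c x y : R).

(** By the mean value theorem the secant slope is a value of [f] between the two points, and
    monotonicity compares it with [f x]. *)
Lemma tangent_le_segment F f a b :
  (forall x, a <= x <= b -> is_derive x 1 F (f x)) ->
  (forall x y, a <= x -> x <= y -> y <= b -> f x <= f y) ->
  forall x y, a <= x <= b -> a <= y <= b -> F x + f x * (y - x) <= F y.
Proof.
move=> dF fmono.
have mvt u v : a <= u -> u <= v -> v <= b ->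
    exists2 c, (u <= c) && (c <= v) & F v - F u = f c * (v - u).
  move=> au uv vb.
  have duv x : x \in `[u, v]%R -> is_derive x 1 F (f x).
    rewrite in_itv/= => /andP[ux xv]; apply: dF.
    by rewrite (le_trans au ux) (le_trans xv vb).
  have cF : {within `[u, v], continuous F}%classic.
    apply: derivable_within_continuous => x xuv.
    by have [] := duv x xuv.
  have duv' x : x \in `]u, v[%R -> is_derive x 1 F (f x).
    by move=> /subset_itv_oo_cc; exact: duv.
  have [c cuv e] := MVT_segment uv duv' cF.
  by exists c => //; move: cuv; rewrite in_itv.
move=> x y /andP[ax xb] /andP[ay yb]; case: (leP x y) => xy.
  have [c /andP[xc cy]] := mvt x y ax xy yb.
  have := ler_wpM2r (_ : 0 <= y - x) (fmono x c ax xc (le_trans cy yb)).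
  by rewrite subr_ge0 => /(_ xy); lra.
have yx := ltW xy.
have [c /andP[yc cx]] := mvt y x ay yx xb.
have := ler_wpM2r (_ : 0 <= x - y) (fmono c x (le_trans ay yc) cx xb).
by rewrite subr_ge0 => /(_ yx); lra.
Qed.

(** When [c] separates [x] from [y], adding the two tangent inequalities between [x] and [c] orders
    [f x] and [f c]; beyond [c] the tangent at [x] then stays below the tangent at [c]. *)
Lemma tangent_le_glue F f c b :
  (forall x y, x <= c -> y <= c -> F x + f x * (y - x) <= F y) ->
  (forall x y, c <= x <= b -> c <= y <= b -> F x + f x * (y - x) <= F y) ->
  forall x y, x <= b -> y <= b -> F x + f x * (y - x) <= F y.
Proof.
move=> left_c right_c x y xb yb.
case: (leP x c) => xc; case: (leP y c) => yc; first exact: left_c.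
- have ccb : c <= c <= b by rewrite lexx (ltW (lt_le_trans yc yb)).
  have cyb : c <= y <= b by rewrite (ltW yc).
  have T1 := left_c x c xc (lexx c); have T2 := left_c c x (lexx c) xc.
  have T3 := right_c c y ccb cyb.
  move: xc; rewrite le_eqVlt => /predU1P[->//|xc].
  have fxc : f x <= f c by nra.
  nra.
- have ccb : c <= c <= b by rewrite lexx (ltW (lt_le_trans xc xb)).
  have cxb : c <= x <= b by rewrite (ltW xc).
  have T1 := right_c x c cxb ccb; have T2 := right_c c x ccb cxb.
  have T3 := left_c c y (lexx c) yc.
  have fxc : f c <= f x by nra.
  nra.
- by apply: right_c; rewrite ltW.
Qed.

End TangentInequalities.

(** * Quadratic bounds for the relaxed logarithm *)

Section RelaxedLog.
Variables (R : realType) (delta : R).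
Hypothesis delta_gt0 : 0 < delta.
Implicit Types (b z : R).

(** The derivative of [Bhat delta] as an explicit formula; gluing tangent inequalities replaces a
    proof of derivability at [delta]. *)
Definition Bslope z : R :=
  if delta < z then - z^-1 else (z - 2 * delta) / delta ^+ 2.

Lemma Bhat_ge z : delta <= z -> Bhat delta z = - ln z.
Proof.
rewrite /Bhat le_eqVlt => /predU1P[<-|->//].
by rewrite ltxx /beta2; field; rewrite gt_eqF.
Qed.

Lemma Bslope_ge z : delta <= z -> Bslope z = - z^-1.
Proof.
rewrite /Bslope le_eqVlt => /predU1P[<-|->//].
by rewrite ltxx; field; rewrite gt_eqF.
Qed.

Lemma Bhat_le z : z <= delta -> Bhat delta z = beta2 delta z.
Proof. by rewrite /Bhat; case: ltgtP. Qed.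

Lemma Bslope_le z : z <= delta -> Bslope z = (z - 2 * delta) / delta ^+ 2.
Proof. by rewrite /Bslope; case: ltgtP. Qed.

Lemma beta2_taylor z0 z :
  beta2 delta z = beta2 delta z0 + (z0 - 2 * delta) / delta ^+ 2 * (z - z0)
                  + (z - z0) ^+ 2 / (2 * delta ^+ 2).
Proof. by rewrite /beta2; field; rewrite gt_eqF. Qed.

Lemma is_derive_ln_sqr (s k z : R) : 0 < z ->
  is_derive z 1 (fun z => s * ln z + k * z ^+ 2) (s / z + 2 * k * z).
Proof.
move=> z0.
have dln := is_derive1_ln z0.
apply: is_derive_eq.
by rewrite !scaler1 /= /GRing.scale/=; ring.
Qed.

(** The curvature of [Bhat] is [1 / delta^2] below [delta] and [1 / z^2 >= 1 / b^2] on [[delta, b]],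
    so subtracting [z^2 / (2 b^2)] leaves a convex function on [z <= b]. *)
Lemma Bhat_lower b z0 z : delta <= b -> z0 <= b -> z <= b ->
  Bhat delta z0 + Bslope z0 * (z - z0) + (z - z0) ^+ 2 / (2 * b ^+ 2)
    <= Bhat delta z.
Proof.
move=> db z0b zb; have b0 := lt_le_trans delta_gt0 db.
set k := (2 * b ^+ 2)^-1.
have k0 : 0 < k by rewrite invr_gt0 mulr_gt0 ?exprn_gt0.
suff : Bhat delta z0 - k * z0 ^+ 2 + (Bslope z0 - 2 * k * z0) * (z - z0)
    <= Bhat delta z - k * z ^+ 2 by lra.
apply: (tangent_le_glue (F := fun z => Bhat delta z - k * z ^+ 2)
   (f := fun z => Bslope z - 2 * k * z) (c := delta) (b := b)) => // x y.
  move=> xd yd; rewrite !Bhat_le// Bslope_le// (beta2_taylor x y).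
  have : (y - x) ^+ 2 * k <= (y - x) ^+ 2 / (2 * delta ^+ 2).
    rewrite ler_wpM2l ?sqr_ge0// /k lef_pV2 ?posrE ?mulr_gt0 ?exprn_gt0//.
    by rewrite ler_pM2l// ler_pXn2r ?nnegrE// ltW.
  by lra.
move=> /andP[dx xb] /andP[dy yb]; rewrite !Bhat_ge// Bslope_ge//.
have pos u : delta <= u -> 0 < u by exact: lt_le_trans.
have dF u : delta <= u <= b -> is_derive u 1
    (fun z => -1 * ln z + (- k) * z ^+ 2) (-1 / u + 2 * (- k) * u).
  by move=> /andP[du _]; exact: is_derive_ln_sqr (pos _ du).
have mono u v : delta <= u -> u <= v -> v <= b ->
    -1 / u + 2 * (- k) * u <= -1 / v + 2 * (- k) * v.
  move=> du uv vb.
  have u0 := pos _ du; have v0 := pos _ (le_trans du uv).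
  have -> : -1 / v = -1 / u + (v - u) / (u * v).
    by field; rewrite !gt_eqF.
  suff : (v - u) * (2 * k) <= (v - u) / (u * v) by lra.
  rewrite ler_wpM2l ?subr_ge0// /k invfM mulrA divff ?mul1r//.
  rewrite lef_pV2 ?posrE ?exprn_gt0 ?mulr_gt0// expr2.
  by apply: ler_pM; rewrite ?(ltW u0) ?(ltW v0)//; exact: le_trans vb.
have := tangent_le_segment dF mono (x := x) (y := y).
by rewrite dx dy xb yb => /(_ isT isT); lra.
Qed.

(** The curvature nowhere exceeds [1 / delta^2], so [z^2 / (2 delta^2) - Bhat] is convex; [b] only
    closes the segment for the mean value theorem. *)
Lemma Bhat_upper z0 z : Bhat delta z <=
  Bhat delta z0 + Bslope z0 * (z - z0) + (z - z0) ^+ 2 / (2 * delta ^+ 2).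
Proof.
set k := (2 * delta ^+ 2)^-1; set b := Num.max z0 z.
have k0 : 0 < k by rewrite invr_gt0 mulr_gt0 ?exprn_gt0.
have z0b : z0 <= b by rewrite le_max lexx.
have zb : z <= b by rewrite le_max lexx orbT.
suff : k * z0 ^+ 2 - Bhat delta z0 + (2 * k * z0 - Bslope z0) * (z - z0)
    <= k * z ^+ 2 - Bhat delta z by lra.
apply: (tangent_le_glue (F := fun z => k * z ^+ 2 - Bhat delta z)
   (f := fun z => 2 * k * z - Bslope z) (c := delta) (b := b)) => // x y.
  by move=> xd yd; rewrite !Bhat_le// Bslope_le// (beta2_taylor x y) -/k; lra.
move=> /andP[dx xb] /andP[dy yb]; rewrite !Bhat_ge// Bslope_ge//.
have pos u : delta <= u -> 0 < u by exact: lt_le_trans.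
have dF u : delta <= u <= b -> is_derive u 1
    (fun z => 1 * ln z + k * z ^+ 2) (1 / u + 2 * k * u).
  by move=> /andP[du _]; exact: is_derive_ln_sqr (pos _ du).
have mono u v : delta <= u -> u <= v -> v <= b ->
    1 / u + 2 * k * u <= 1 / v + 2 * k * v.
  move=> du uv vb.
  have u0 := pos _ du; have v0 := pos _ (le_trans du uv).
  have -> : 1 / v = 1 / u - (v - u) / (u * v).
    by field; rewrite !gt_eqF.
  suff : (v - u) / (u * v) <= (v - u) * (2 * k) by lra.
  have -> : 2 * k = (delta ^+ 2)^-1 by rewrite /k; field; rewrite gt_eqF.
  rewrite ler_wpM2l ?subr_ge0//.
  rewrite lef_pV2 ?posrE ?exprn_gt0 ?mulr_gt0// expr2.
  by apply: ler_pM; rewrite ?(ltW delta_gt0)//; exact: le_trans uv.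
have := tangent_le_segment dF mono (x := x) (y := y).
by rewrite dx dy xb yb => /(_ isT isT); lra.
Qed.

(** The Bregman divergence of [Bhat delta]. An admissible recentering leaves a weighted sum of
    these, based at [z0 = d i 0]. *)
Definition Bdiv z0 z := Bhat delta z - Bhat delta z0 - Bslope z0 * (z - z0).

Lemma Bdiv_ge0 z0 z : 0 <= Bdiv z0 z.
Proof.
set b := Num.max delta (Num.max z0 z).
have := @Bhat_lower b z0 z.
rewrite {1 2 3}/b !le_max !lexx !orbT => /(_ isT isT isT).
have : 0 <= (z - z0) ^+ 2 / (2 * b ^+ 2).
  by apply: divr_ge0; [|apply: mulr_ge0 => //]; exact: sqr_ge0.
by rewrite /Bdiv; lra.
Qed.

Lemma Bdiv_le z0 z : Bdiv z0 z <= (z - z0) ^+ 2 / (2 * delta ^+ 2).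
Proof. by rewrite /Bdiv; have := Bhat_upper z0 z; lra. Qed.

(* Convexity of the Bregman divergence [Bdiv z0] turns its quadratic growth on
   [z0 - 1, z0 + 1] into linear growth outside. *)
Lemma Bdiv_growth z0 : exists2 k, 0 < k &
  forall z, (z - z0) ^+ 2 <= k * (1 + `|z - z0|) * Bdiv z0 z.
Proof.
set b := Num.max delta (z0 + 1); pose k := 2 * b ^+ 2.
have db : delta <= b by rewrite le_max lexx.
have z0b : z0 + 1 <= b by rewrite le_max lexx orbT.
have b0 := lt_le_trans delta_gt0 db.
have k0 : 0 < k by rewrite mulr_gt0 ?exprn_gt0.
exists k => // z.
have low x y : x <= z0 + 1 -> y <= z0 + 1 -> (y - x) ^+ 2 <= k * Bdiv x y.
  move=> xz yz; rewrite mulrC -ler_pdivrMr// /k /Bdiv.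
  by have := Bhat_lower db (le_trans xz z0b) (le_trans yz z0b); lra.
have D0 := Bdiv_ge0 z0 z.
case: (lerP `|z - z0| 1) => zz.
  have zz0 : z <= z0 + 1 by move: zz; rewrite ler_norml; lra.
  have := low z0 z (ltac:(lra)) zz0 => /le_trans; apply.
  rewrite -mulrA ler_pM2l//; have := normr_ge0 (z - z0); nra.
set z1 := z0 + Num.sg (z - z0).
have sq1 : Num.sg (z - z0) ^+ 2 = 1.
  by rewrite sqr_sg; case: eqVneq zz => // ->; rewrite normr0 ltr10.
have sg1 : Num.sg (z - z0) <= 1 by case: sgrP.
have L1 : 1 <= k * Bdiv z0 z1.
  by rewrite -sq1; have := low z0 z1; rewrite /z1 addrAC subrr add0r; apply; lra.
have L2 : 1 <= k * Bdiv z1 z0.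
  have := low z1 z0; rewrite /z1 opprD addrA subrr add0r sqrrN sq1.
  by apply; lra.
have D1 := Bdiv_ge0 z1 z.
set n := `|z - z0| in zz *.
have zE : z - z0 = n * Num.sg (z - z0) by rewrite mulrC /n -numEsg.
(* Three-point identity: [z1] lies one unit from [z0] towards [z], so [z - z1] is [n - 1] times
   [z1 - z0], and the slope gap times [z1 - z0] is the symmetrized divergence. *)
have key : Bdiv z0 z = Bdiv z1 z + Bdiv z0 z1
    + (n - 1) * (Bdiv z0 z1 + Bdiv z1 z0).
  have -> : z = z0 + n * Num.sg (z - z0) by rewrite -zE; ring.
  by rewrite /Bdiv /z1; ring.
have kD : n <= k * Bdiv z0 z.
  have -> : k * Bdiv z0 z = k * Bdiv z1 z + k * Bdiv z0 z1
      + (n - 1) * (k * Bdiv z0 z1 + k * Bdiv z1 z0) by rewrite key; ring.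
  have : 0 <= k * Bdiv z1 z by rewrite mulr_ge0// ltW.
  by nra.
have -> : (z - z0) ^+ 2 = n ^+ 2 by rewrite /n real_normK ?num_real.
by nra.
Qed.

(** Squeezing between the tangent at [z0] and the parabola of [Bhat_upper] avoids a case split at
    [delta]. *)
Lemma continuous_Bhat : continuous (Bhat delta).
Proof.
move=> z0; set k := (2 * delta ^+ 2)^-1.
set lo := fun z => Bhat delta z0 + Bslope z0 * (z - z0).
set up := fun z => Bhat delta z0 + Bslope z0 * (z - z0) + (z - z0) ^+ 2 * k.
apply: (@squeeze_cvgr _ _ _ _ lo up).
- apply: nearW => z; rewrite Bhat_upper andbT.
  by have := Bdiv_ge0 z0 z; rewrite /Bdiv /lo; lra.
- have -> : Bhat delta z0 = lo z0 by rewrite /lo subrr mulr0 addr0.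
  apply: cvgD; first exact: cvg_cst.
  by apply: cvgM; [exact: cvg_cst|apply: cvgB; [exact: cvg_id|exact: cvg_cst]].
- have -> : Bhat delta z0 = up z0 by rewrite /up subrr expr0n mulr0 mul0r !addr0.
  have cz : (z - z0 @[z --> z0] --> z0 - z0)%classic.
    by apply: cvgB; [exact: cvg_id|exact: cvg_cst].
  apply: cvgD.
    by apply: cvgD; [exact: cvg_cst|apply: cvgM; [exact: cvg_cst|]].
  by apply: cvgM; [rewrite expr2; under eq_fun do rewrite expr2; exact: cvgM|exact: cvg_cst].
Qed.

End RelaxedLog.

(** * Recentered barriers *)

Section Barrier.
Local Open Scope classical_set_scope.
Local Open Scope ring_scope.
Variables (R : realType) (p n : nat) (g : bool).
Variables (C : 'M[R]_(p, n)) (d w : 'cV[R]_p) (delta : R).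
Hypotheses (delta_gt0 : 0 < delta) (rec_ok : recentering_ok g C d w).
Implicit Types x v : 'cV[R]_n.

Let w_ge0 i : 0 <= w i 0.
Proof. by move: rec_ok; rewrite /recentering_ok; case: g => [->|[]//]; rewrite mxE. Qed.

Lemma qf_Mmat x :
  qf (Mmat delta C w) x
    = \sum_i (1 + w i 0) * ((C *m x) i 0 ^+ 2 / (2 * delta ^+ 2)).
Proof.
rewrite /qf /Mmat -scalemxAr -scalemxAl mxE.
have -> : x^T *m (C^T *m diag_mx (const_mx 1 + w)^T *m C) *m x
    = (C *m x)^T *m diag_mx (const_mx 1 + w)^T *m (C *m x).
  by rewrite trmx_mul !mulmxA.
rewrite mul_mx_diag mxE mulr_sumr; apply: eq_bigr => i _.
by rewrite !mxE; ring.
Qed.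

(** Second-order remainder of the barrier at the origin. The factor [1 + w i 0] also covers gradient
    recentering, where [w = 0]. *)
Let bdiv x := \sum_i (1 + w i 0) * Bdiv delta (d i 0) (zc C d x i).

Let bdiv_ge0 x : 0 <= bdiv x.
Proof.
apply: sumr_ge0 => i _; apply: mulr_ge0; last exact: Bdiv_ge0.
by rewrite addr_ge0.
Qed.

Let bdiv_le x : bdiv x <= qf (Mmat delta C w) x.
Proof.
rewrite qf_Mmat; apply: ler_sum => i _; apply: ler_wpM2l.
  by rewrite addr_ge0.
have := Bdiv_le delta_gt0 (d i 0) (zc C d x i).
by rewrite {2}/zc addrK sqrrN.
Qed.

Let lin x := \sum_i (- ((1 + w i 0) * Bslope delta (d i 0) * (C *m x) i 0)
                   - (if g then (C *m x) i 0 / d i 0 else 0)).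

Let linZ t v : lin (t *: v) = t * lin v.
Proof.
rewrite /lin mulr_sumr; apply: eq_bigr => i _.
by rewrite -scalemxAr mxE; case: g; ring.
Qed.

Let barrier_split x :
  barrier g C d w delta x = barrier g C d w delta 0 + lin x + bdiv x.
Proof.
rewrite /barrier /lin /bdiv -!big_split/=; apply: eq_bigr => i _.
have C0 : (C *m (0 : 'cV_n)) i 0 = 0 by rewrite mulmx0 mxE.
rewrite /barrier_term /Bdiv /zc C0 oppr0 add0r.
move: rec_ok ((C *m x) i 0) => + c.
by rewrite /recentering_ok; case: g => [->|_]; rewrite ?mxE; ring.
Qed.

Hypothesis adm : admissible (barrier g C d w delta).

(* The remainder [bdiv] is quadratically small, so the linear part is the
   gradient at the origin. *)
Lemma barrier_Bdiv x : barrier g C d w delta x =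
  \sum_i (1 + w i 0) * Bdiv delta (d i 0) (zc C d x i).
Proof.
have [b0 db] := adm.
suff lin0 : lin x = 0 by rewrite barrier_split b0 lin0 !add0r.
set q := qf (Mmat delta C w) x.
have qE t : qf (Mmat delta C w) (t *: x) = t ^+ 2 * q.
  rewrite /q !qf_Mmat mulr_sumr; apply: eq_bigr => i _.
  by rewrite -scalemxAr mxE; ring.
have cvg0 : (h^-1 * barrier g C d w delta (h *: x) @[h --> 0^'] --> (0 : R))%classic.
  (* The difference quotient in the literal form used by the definition of the derivative, so that
     admissibility applies to it. *)
  pose F (h : R) := h^-1 *: (((fun t : R => barrier g C d w delta (t *: x))
    \o shift 0) (h *: 1) - barrier g C d w delta (0 *: x)).
  have FE : F = (fun h => h^-1 * barrier g C d w delta (h *: x)).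
    apply/funext => h.
    by rewrite /F /= scale0r b0 subr0 addr0 -[h *: 1]/(h * 1) mulr1.
  have cF : F h @[h --> 0^'] --> lim (F h @[h --> 0^']).
    exact: (@ex_derive _ _ _ _ _ _ _ (db x)).
  have dF : lim (F h @[h --> 0^']) = 0 := @derive_val _ _ _ _ _ _ _ (db x).
  by rewrite -FE -[X in _ --> X]dF.
(* The same quotient differs from [lin x] by at most [|h| * q], since [bdiv (h *: x) <= h^2 * q]. *)
have cvgL : (h^-1 * barrier g C d w delta (h *: x) @[h --> 0^'] --> lin x)%classic.
  have q0 : 0 <= q by apply: le_trans (bdiv_ge0 x) (bdiv_le x).
  have ch : (`|h| * q @[h --> (0 : R)^'] --> 0)%classic.
    suff : `|h| * q @[h --> (0 : R)^'] --> `|0 : R| * q by rewrite normr0 mul0r.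
    apply: cvgM; last exact: cvg_cst.
    by apply: cvg_norm; exact: cvg_within.
  apply: (@squeeze_cvgr _ _ _ _ (fun h => lin x - `|h| * q) (fun h => lin x + `|h| * q)).
  - near=> h.
    have h0 : h != 0 by near: h; exact: nbhs_dnbhs_neq.
    rewrite -ler_distl barrier_split b0 add0r linZ mulrDr mulKf// addrAC subrr add0r.
    rewrite normrM normfV (ger0_norm (bdiv_ge0 _)).
    rewrite ler_pdivrMl ?normr_gt0//; apply: le_trans (bdiv_le _) _.
    by rewrite qE mulrA -expr2 real_normK ?num_real.
  - rewrite -[X in _ --> X]subr0; apply: cvgB => //; exact: cvg_cst.
  - rewrite -[X in _ --> X]addr0; apply: cvgD => //; exact: cvg_cst.
exact: cvg_unique cvgL cvg0.
Unshelve. all: by end_near.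
Qed.

Lemma barrier_ge0 x : 0 <= barrier g C d w delta x.
Proof. by rewrite barrier_Bdiv; exact: bdiv_ge0. Qed.

Lemma barrier_le_qf x : barrier g C d w delta x <= qf (Mmat delta C w) x.
Proof. by rewrite barrier_Bdiv; exact: bdiv_le. Qed.

(** Converse of [barrier_le_qf]. For large slack the barrier grows only linearly, hence its square
    on the right. This lets the stage cost control [W x]. *)
Lemma qf_le_barrier : exists2 k, 0 <= k & forall x,
  qf (Mmat delta C w) x
    <= k * (barrier g C d w delta x + barrier g C d w delta x ^+ 2).
Proof.
have /choice[k kP] i : exists k, 0 < k /\ forall z,
    (z - d i 0) ^+ 2 <= k * (1 + `|z - d i 0|) * Bdiv delta (d i 0) z.
  by have [k k0 kP] := Bdiv_growth delta_gt0 (d i 0); exists k.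
have k0 i : 0 < k i by have [] := kP i.
have dd0 : 0 < 2 * delta ^+ 2 by rewrite mulr_gt0 ?exprn_gt0.
(* With [c] the constraint value and [b] the barrier, [c^2 <= k b + k b |c|] and
   [k b |c| <= (k^2 b^2 + c^2) / 2] give [c^2 <= 2 k b + k^2 b^2]. *)
pose K i := (1 + w i 0) * ((2 * k i + k i ^+ 2) / (2 * delta ^+ 2)).
have w1 i : 0 <= 1 + w i 0 by rewrite addr_ge0.
exists (\sum_i K i) => [|x].
  apply: sumr_ge0 => i _; apply: mulr_ge0 => //; apply: divr_ge0; last exact: ltW.
  by rewrite addr_ge0 ?sqr_ge0// mulr_ge0// ltW.
rewrite qf_Mmat mulr_suml; apply: ler_sum => i _.
rewrite /K -[leRHS]mulrA; apply: ler_wpM2l => //.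
rewrite [leRHS]mulrAC ler_pM2r ?invr_gt0//.
set b := barrier _ _ _ _ _ _.
have b0 : 0 <= b by exact: barrier_ge0.
have [_ /(_ (zc C d x i))] := kP i.
rewrite {1 2}/zc addrK sqrrN normrN; set c := (C *m x) i 0 => cP.
have Db : Bdiv delta (d i 0) (zc C d x i) <= b.
  rewrite /b barrier_Bdiv (bigD1 i)//=.
  set D := Bdiv _ _ _; set S := \sum_(_ | _) _.
  have D0 : 0 <= D by exact: Bdiv_ge0.
  have S0 : 0 <= S.
    by apply: sumr_ge0 => j _; apply: mulr_ge0 => //; exact: Bdiv_ge0.
  by have := w_ge0 i; nra.
have ki := k0 i.
have cP2 : c ^+ 2 <= k i * b + k i * b * `|c|.
  apply: le_trans cP _; rewrite -mulrA mulrDl mul1r mulrDr.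
  have : k i * Bdiv delta (d i 0) (zc C d x i) <= k i * b by rewrite ler_pM2l.
  by have := normr_ge0 c; nra.
have cc : `|c| ^+ 2 = c ^+ 2 by rewrite real_normK ?num_real.
have := sqr_ge0 (k i * b - `|c|).
have : 0 <= k i * b ^+ 2 by rewrite mulr_ge0 ?sqr_ge0// ltW.
have : 0 <= k i ^+ 2 * b by rewrite mulr_ge0 ?sqr_ge0.
rewrite sqrrB cc; nra.
Qed.

End Barrier.

(** * Norms and quadratic forms *)

Section L1Norm.
Variable R : realType.

(** The l1 norm makes the matrix estimates coordinatewise; it is compared with [enorm] below. *)
Definition nrm n (x : 'cV[R]_n) : R := \sum_i `|x i 0|.

Lemma nrm_ge0 n (x : 'cV[R]_n) : 0 <= nrm x.
Proof. by apply: sumr_ge0. Qed.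

Lemma nrmD n (x y : 'cV[R]_n) : nrm (x + y) <= nrm x + nrm y.
Proof.
by rewrite /nrm -big_split; apply: ler_sum => i _; rewrite mxE ler_normD.
Qed.

Lemma nrmN n (x : 'cV[R]_n) : nrm (- x) = nrm x.
Proof. by apply: eq_bigr => i _; rewrite mxE normrN. Qed.

Lemma coord_le_nrm n (x : 'cV[R]_n) i : `|x i 0| <= nrm x.
Proof. by rewrite /nrm (bigD1 i)//= lerDl sumr_ge0. Qed.

Lemma nrm_le_coord n (x : 'cV[R]_n) a :
  (forall i, `|x i 0| <= a) -> nrm x <= n%:R * a.
Proof.
move=> xa; have : nrm x <= \sum_(i < n) a by apply: ler_sum.
by rewrite sumr_const card_ord mulr_natl.
Qed.

Lemma nrm_mul p n (M : 'M[R]_(p, n)) : exists2 C, 0 <= C &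
  forall x : 'cV[R]_n, nrm (M *m x) <= C * nrm x.
Proof.
exists (\sum_i \sum_j `|M i j|) => [|x].
  by apply: sumr_ge0 => i _; apply: sumr_ge0.
rewrite /nrm mulr_suml; apply: ler_sum => i _.
rewrite mxE mulr_suml; apply: le_trans (ler_norm_sum _ _ _) _.
apply: ler_sum => j _; rewrite normrM; apply: ler_wpM2l => //.
exact: coord_le_nrm.
Qed.

Lemma enorm_le_nrm n (x : 'cV[R]_n) : enorm x <= nrm x.
Proof.
rewrite -(ger0_norm (nrm_ge0 x)) -sqrtr_sqr; apply: ler_wsqrtr.
rewrite expr2 {1}/nrm mulr_suml; apply: ler_sum => i _.
by rewrite -real_normK ?num_real// expr2 ler_wpM2l// coord_le_nrm.
Qed.

Lemma nrm_le_enorm n (x : 'cV[R]_n) : nrm x <= n%:R * enorm x.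
Proof.
apply: nrm_le_coord => i; rewrite -sqrtr_sqr; apply: ler_wsqrtr.
by rewrite (bigD1 i)//= lerDl sumr_ge0// => j _; rewrite sqr_ge0.
Qed.

End L1Norm.

(** * Quadratic forms of semidefinite matrices *)

Section QuadraticForms.
Variable R : realType.

Definition bf p n (M : 'M[R]_(p, n)) (x : 'cV[R]_p) (y : 'cV[R]_n) : R :=
  (x^T *m M *m y) 0 0.

Lemma qf0 n (M : 'M[R]_n) : qf M 0 = 0.
Proof. by rewrite /qf mulmx0 mxE. Qed.

Lemma qfZr n (M : 'M[R]_n) a x : qf M (a *: x) = a ^+ 2 * qf M x.
Proof. by rewrite /qf [(a *: x)^T]linearZ/= -!scalemxAl -scalemxAr !mxE mulrA. Qed.

Lemma qfDl n (M N : 'M[R]_n) x : qf (M + N) x = qf M x + qf N x.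
Proof. by rewrite /qf mulmxDr mulmxDl mxE. Qed.

Lemma qfZl n (M : 'M[R]_n) a x : qf (a *: M) x = a * qf M x.
Proof. by rewrite /qf -scalemxAr -scalemxAl mxE. Qed.

Lemma qf_mul p n (M : 'M[R]_p) (T : 'M[R]_(p, n)) x :
  qf (T^T *m M *m T) x = qf M (T *m x).
Proof. by rewrite /qf trmx_mul !mulmxA. Qed.

Lemma qfDr n (M : 'M[R]_n) x y : Defs.symmetric M ->
  qf M (x + y) = qf M x + 2 * bf M x y + qf M y.
Proof.
move=> symM.
have -> : 2 * bf M x y = bf M x y + bf M y x.
  rewrite mulr2n mulrDl !mul1r; congr (_ + _).
  by rewrite /bf -[x^T *m M *m y]trmxK mxE !trmx_mul trmxK symM mulmxA.
by rewrite /qf /bf [(x + y)^T]linearD/= mulmxDr !mulmxDl !mxE; ring.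
Qed.

(** Cauchy-Schwarz for a possibly degenerate form: [qf M (t *: x + y)] is a nonnegative polynomial
    in [t]. *)
Lemma bf_sqr_le n (M : 'M[R]_n) x y : psd M ->
  bf M x y ^+ 2 <= qf M x * qf M y.
Proof.
move=> [symM M0].
have quad t : 0 <= t ^+ 2 * qf M x + 2 * t * bf M x y + qf M y.
  have := M0 (t *: x + y); rewrite qfDr// qfZr.
  by rewrite {1}/bf [(t *: x)^T]linearZ/= -!scalemxAl mxE -/(bf M x y) mulrA.
have := M0 x; rewrite le_eqVlt => /predU1P[a0|a0].
  suff -> : bf M x y = 0 by rewrite -a0 expr0n mul0r.
  apply/eqP/negPn/negP => b0.
  (* The polynomial is affine here, and this [t] gives it the value [-1]. *)
  have := quad (- (qf M y + 1) / (2 * bf M x y)).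
  rewrite -a0 mulr0 add0r.
  have -> : 2 * (- (qf M y + 1) / (2 * bf M x y)) * bf M x y = - (qf M y + 1).
    by field.
  by lra.
have := quad (- bf M x y / qf M x).
have -> : (- bf M x y / qf M x) ^+ 2 * qf M x
   + 2 * (- bf M x y / qf M x) * bf M x y + qf M y
   = qf M y - bf M x y ^+ 2 / qf M x by field; rewrite gt_eqF.
by rewrite subr_ge0 ler_pdivrMr// mulrC.
Qed.

(** A semidefinite form controls [M x] even where it does not control [x]: each coordinate of [M x]
    is [bf M] against a basis vector. *)
Lemma psd_nrm n (M : 'M[R]_n) : psd M -> exists2 C, 0 <= C &
  forall x, nrm (M *m x) <= C * Num.sqrt (qf M x).
Proof.
move=> psdM; have [_ M0] := psdM.
exists (\sum_i Num.sqrt (qf M (delta_mx i 0))) => [|x].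
  by apply: sumr_ge0 => i _; rewrite sqrtr_ge0.
rewrite /nrm mulr_suml; apply: ler_sum => i _.
have -> : (M *m x) i 0 = bf M (delta_mx i 0) x.
  by rewrite /bf trmx_delta -mulmxA -rowE [RHS]mxE.
rewrite -sqrtrM// -sqrtr_sqr; apply: ler_wsqrtr.
exact: bf_sqr_le.
Qed.

Lemma pd_psd n (M : 'M[R]_n) : pd M -> psd M.
Proof.
move=> [symM M0]; split=> // x; have [->|/M0/ltW//] := eqVneq x 0.
by rewrite qf0.
Qed.

Lemma pd_unitmx n (M : 'M[R]_n) : pd M -> M \in unitmx.
Proof.
move=> [symM M0]; rewrite -row_free_unit -kermx_eq0; apply/eqP/row_matrixP => i.
rewrite row0; apply/eqP/negPn/negP => r0.
set r := row i _ in r0; have rM : r *m M = 0.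
  by apply/eqP; rewrite -sub_kermx row_sub.
have := M0 r^T; rewrite /qf trmxK rM mul0mx mxE ltxx => h.
by have := h; rewrite -(inj_eq (@trmx_inj _ _ _)) trmxK trmx0 => /(_ r0).
Qed.

Lemma pd_nrm n (M : 'M[R]_n) : pd M -> exists2 C, 0 <= C &
  forall x, nrm x <= C * Num.sqrt (qf M x).
Proof.
move=> pdM; have [C C0 CP] := psd_nrm (pd_psd pdM).
have [D D0 DP] := nrm_mul (invmx M).
exists (D * C) => [|x]; first exact: mulr_ge0.
rewrite -{1}(mulKmx (pd_unitmx pdM) x); apply: le_trans (DP _) _.
by rewrite -mulrA ler_wpM2l.
Qed.

Lemma qf_le_nrm n (M : 'M[R]_n) : exists2 C, 0 <= C &
  forall x, qf M x <= C * nrm x ^+ 2.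
Proof.
have [C C0 CP] := nrm_mul M; exists C => // x.
rewrite /qf -mulmxA mxE; apply: (@le_trans _ _ (\sum_i `|x i 0| * nrm (M *m x))).
  apply: ler_sum => i _; rewrite mxE; apply: le_trans (ler_norm _) _.
  by rewrite normrM ler_wpM2l// coord_le_nrm.
by rewrite -mulr_suml expr2 mulrCA ler_wpM2l ?nrm_ge0.
Qed.

Lemma psdD n (M N : 'M[R]_n) : psd M -> psd N -> psd (M + N).
Proof.
move=> [sM M0] [sN N0]; split; first by rewrite /Defs.symmetric linearD/= sM sN.
by move=> x; rewrite qfDl addr_ge0.
Qed.

Lemma pdD_psd n (M N : 'M[R]_n) : pd M -> psd N -> pd (M + N).
Proof.
move=> [sM M0] [sN N0]; split; first by rewrite /Defs.symmetric linearD/= sM sN.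
by move=> x x0; rewrite qfDl ltr_wpDr ?M0.
Qed.

Lemma psdZ n (M : 'M[R]_n) a : 0 <= a -> psd M -> psd (a *: M).
Proof.
move=> a0 [sM M0]; split; first by rewrite /Defs.symmetric linearZ/= sM.
by move=> x; rewrite qfZl mulr_ge0.
Qed.

Lemma psd_congr p n (M : 'M[R]_p) (T : 'M[R]_(p, n)) :
  psd M -> psd (T^T *m M *m T).
Proof.
move=> [sM M0]; split; first by rewrite /Defs.symmetric !trmx_mul trmxK sM mulmxA.
by move=> x; rewrite qf_mul.
Qed.

Lemma psd_Mmat p n g (C : 'M[R]_(p, n)) d w delta : 0 < delta ->
  recentering_ok g C d w -> psd (Mmat delta C w).
Proof.
move=> delta0 rec; rewrite /Mmat; apply: psdZ.
  by rewrite invr_ge0 mulr_ge0// exprn_ge0// ltW.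
apply: psd_congr; split; first by rewrite /Defs.symmetric tr_diag_mx.
move=> x; rewrite /qf mul_mx_diag mxE; apply: sumr_ge0 => i _.
rewrite !mxE mulrAC -expr2 mulr_ge0 ?sqr_ge0// addr_ge0//.
by move: rec; rewrite /recentering_ok; case: g => [->|[]//]; rewrite mxE.
Qed.

End QuadraticForms.

(** * The modified Riccati equation *)

Section Riccati.
Variables (R : realType) (n m : nat) (A : 'M[R]_n) (B : 'M[R]_(n, m)).
Variables (P W : 'M[R]_n) (Rt : 'M[R]_m) (K : 'M[R]_(m, n)).
Let S := Rt + B^T *m P *m B.
Let AK := A + B *m K.
Hypotheses (pdP : pd P) (pdRt : pd Rt).
Hypothesis defK : K = - (invmx S *m B^T *m P *m A).
Hypothesis defP : P = AK^T *m P *m AK + K^T *m Rt *m K + W.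

Lemma riccati_pd : pd S.
Proof. by apply: pdD_psd => //; exact/psd_congr/pd_psd. Qed.

(** This is [S K = - B^T P A] with [B^T P B K] moved across. The formula for [K] enters the argument
    only through this identity. *)
Lemma riccati_gain : B^T *m P *m AK = - (Rt *m K).
Proof.
have : S *m K = - (B^T *m P *m A).
  by rewrite defK mulmxN !mulmxA mulmxV ?mul1mx// pd_unitmx//; exact: riccati_pd.
rewrite /S /AK mulmxDl mulmxDr !mulmxA => /eqP; rewrite -subr_eq0 opprK => /eqP e.
by apply/eqP; rewrite -subr_eq0 opprK; apply/eqP; rewrite -e addrC addrA addrAC.
Qed.

(** Expanding only the factor [AK^T], the term [K^T B^T P AK] cancels [K^T Rt K]. *)
Lemma riccati_short : P = A^T *m P *m AK + W.
Proof.
rewrite {1}defP; congr (_ + _).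
have -> : AK^T = A^T + K^T *m B^T by rewrite [LHS]linearD/= trmx_mul.
rewrite !mulmxDl -addrA -[RHS]addr0; congr (_ + _).
by rewrite -!mulmxA (mulmxA B^T P) riccati_gain mulmxN addNr.
Qed.

Lemma riccati_short_tr : Defs.symmetric W -> P = AK^T *m P *m A + W.
Proof.
move=> sW; have [sP _] := pdP.
by rewrite -{1}sP {1}riccati_short linearD/= sW !trmx_mul trmxK sP mulmxA.
Qed.

(** With [u = K x + e], the cross terms through [P] and through [Rt] cancel by [riccati_gain],
    leaving [qf S e]. *)
Lemma riccati_identity x u :
  qf P (A *m x + B *m u) + qf Rt u + qf W x = qf P x + qf S (u - K *m x).
Proof.
have [sP _] := pdP; have [sR _] := pdRt.
set e := u - K *m x.
have uE : u = K *m x + e by rewrite /e addrC subrK.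
clearbody e.
have -> : A *m x + B *m u = AK *m x + B *m e.
  by rewrite uE /AK mulmxDl mulmxDr mulmxA addrA.
have -> : qf P x = qf P (AK *m x) + qf Rt (K *m x) + qf W x.
  by rewrite {1}defP !qfDl !qf_mul.
rewrite {1}uE !qfDr// /S qfDl qf_mul.
have -> : bf P (AK *m x) (B *m e) = - bf Rt (K *m x) e.
  rewrite /bf !trmx_mul.
  have -> : x^T *m AK^T *m P *m (B *m e) = x^T *m (B^T *m P *m AK)^T *m e.
    by rewrite !trmx_mul sP trmxK !mulmxA.
  by rewrite riccati_gain linearN/= trmx_mul sR mulmxN mulNmx mxE !mulmxA.
by ring.
Qed.

End Riccati.

(** * Existence of optimal inputs *)

Section CoordinatewiseContinuity.
Variables (R : realType) (T : topologicalType).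

Definition ccontinuous n (f : T -> 'cV[R]_n) :=
  forall i, continuous (fun t => f t i 0).

Lemma continuous_sumr I (r : seq I) (F : I -> T -> R) :
  (forall i, continuous (F i)) -> continuous (fun t => \sum_(i <- r) F i t).
Proof.
by move=> cF; apply: continuous_big => // ; exact: add_continuous.
Qed.

Lemma ccontinuous_cst n (c : 'cV[R]_n) : ccontinuous (fun=> c).
Proof. by move=> i t; exact: cvg_cst. Qed.

Lemma ccontinuous_mulmx p n (M : 'M[R]_(p, n)) f :
  ccontinuous f -> ccontinuous (fun t => M *m f t).
Proof.
move=> cf i.
have -> : (fun t => (M *m f t) i 0) = (fun t => \sum_j M i j * f t j 0).
  by apply/funext => t; rewrite mxE.
by apply: continuous_sumr => j t; apply: cvgM; [exact: cvg_cst|exact: cf].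
Qed.

Lemma continuousD_fun (f g : T -> R) :
  continuous f -> continuous g -> continuous (fun t => f t + g t).
Proof. by move=> cf cg t; apply: cvgD; [exact: cf|exact: cg]. Qed.

Lemma ccontinuousD n (f g : T -> 'cV[R]_n) :
  ccontinuous f -> ccontinuous g -> ccontinuous (fun t => f t + g t).
Proof.
move=> cf cg i.
have -> : (fun t => (f t + g t) i 0) = (fun t => f t i 0 + g t i 0).
  by apply/funext => t; rewrite mxE.
exact: continuousD_fun.
Qed.

Lemma continuous_qf n (M : 'M[R]_n) f :
  ccontinuous f -> continuous (fun t => qf M (f t)).
Proof.
move=> cf; have cMf := ccontinuous_mulmx (M := M) cf.
have -> : (fun t => qf M (f t)) = (fun t => \sum_i f t i 0 * (M *m f t) i 0).
  apply/funext => t; rewrite /qf -mulmxA mxE.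
  by apply: eq_bigr => i _; rewrite mxE.
by apply: continuous_sumr => i t; apply: cvgM; [exact: cf|exact: cMf].
Qed.

Lemma continuous_barrier p n g (C : 'M[R]_(p, n)) d w delta f : 0 < delta ->
  ccontinuous f -> continuous (fun t => barrier g C d w delta (f t)).
Proof.
move=> delta0 cf; have cCf := ccontinuous_mulmx (M := C) cf.
apply: continuous_sumr => i t.
have cB : {for t, continuous (fun t => Bhat delta (zc C d (f t) i))}.
  apply: (@continuous_comp _ _ _ (fun t => zc C d (f t) i) (Bhat delta)).
    by apply: cvgD; [apply: cvgN; exact: cCf|exact: cvg_cst].
  exact: continuous_Bhat.
have cBd : {for t, continuous (fun t => Bhat delta (zc C d (f t) i) + ln (d i 0))}.
  by apply: cvgD; [exact: cB|exact: cvg_cst].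
rewrite /barrier_term; case: g; last by apply: cvgM; [exact: cvg_cst|exact: cBd].
apply: cvgB; first exact: cBd.
by apply: cvgM; [exact: cCf|exact: cvg_cst].
Qed.

End CoordinatewiseContinuity.

(** * The finite-horizon cost and its minimizers *)

Section Cost.
Variables (R : realType) (n m : nat) (A : 'M[R]_n) (B : 'M[R]_(n, m)).
Variables (P : 'M[R]_n) (ell : 'cV[R]_n -> 'cV[R]_m -> R) (N : nat).
Hypothesis psdP : psd P.
Hypothesis ell_ge0 : forall x u, 0 <= ell x u.

Definition mpc_cost (x : 'cV[R]_n) (u : nat -> 'cV[R]_m) : R :=
  \sum_(k < N) ell (pstate A B u x k) (u k) + qf P (pstate A B u x N).

Lemma pstate_ext (u v : nat -> 'cV[R]_m) x k :
  (forall j, (j < k)%N -> u j = v j) -> pstate A B u x k = pstate A B v x k.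
Proof.
elim: k => //= k IH uv; rewrite IH ?uv// => j jk; exact/uv/ltnW.
Qed.

Lemma mpc_cost_ext (u v : nat -> 'cV[R]_m) x :
  (forall j, (j < N)%N -> u j = v j) -> mpc_cost x u = mpc_cost x v.
Proof.
move=> uv; rewrite /mpc_cost (pstate_ext x uv); congr (_ + _).
apply: eq_bigr => k _; rewrite uv// (@pstate_ext u v)// => j jk.
by apply: uv; exact: ltn_trans (ltn_ord k).
Qed.

Lemma ell_le_cost x u k : (k < N)%N -> ell (pstate A B u x k) (u k) <= mpc_cost x u.
Proof.
move=> kN; have [_ P0] := psdP.
rewrite /mpc_cost (bigD1 (Ordinal kN))//= -addrA lerDl addr_ge0//.
by apply: sumr_ge0 => i _.
Qed.

Lemma terminal_le_cost x u : qf P (pstate A B u x N) <= mpc_cost x u.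
Proof. by rewrite lerDr sumr_ge0. Qed.

Lemma mpc_cost_ge0 x u : 0 <= mpc_cost x u.
Proof. by apply: le_trans (terminal_le_cost x u); have [_] := psdP. Qed.

(** Weierstrass: input sequences no costlier than zero lie in a compact box, because a bound on the
    stage cost bounds the input uniformly in the state. *)
Lemma mpc_optimal_exists x :
  (forall (T : topologicalType) (f : T -> 'cV[R]_n) (g : T -> 'cV[R]_m),
     ccontinuous f -> ccontinuous g -> continuous (fun t => ell (f t) (g t))) ->
  (forall s, exists r, forall x u, ell x u <= s -> nrm u <= r) ->
  exists u, forall v, mpc_cost x u <= mpc_cost x v.
Proof.
move=> cell coer.
(* Decodes a vector into an input sequence. Past the horizon the value [0] is arbitrary, as the cost
   reads only the first [N] inputs. *)
pose dec (U : 'rV[R]_(N * m)) (k : nat) : 'cV[R]_m :=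
  if insub k is Some i then (row i (vec_mx U))^T else 0.
have cdec k : ccontinuous (dec^~ k).
  move=> j; rewrite /dec; case: insubP => [i _ _|_]; last first.
    exact: (@ccontinuous_cst R 'rV[R]_(N * m) _ 0).
  have -> : (fun t : 'rV[R]_(N * m) => (row i (vec_mx t))^T j 0)
      = (fun t : 'rV[R]_(N * m) => t 0 (mxvec_index i j)).
    by apply/funext => t; rewrite !mxE.
  exact: coord_continuous.
have cst k : ccontinuous (fun U => pstate A B (dec U) x k).
  elim: k => [|k IH] /=; first exact: ccontinuous_cst.
  by apply: ccontinuousD; apply: ccontinuous_mulmx; [exact: IH|exact: cdec].
have cJ : continuous (fun U => mpc_cost x (dec U)).
  apply: (@continuousD_fun R 'rV[R]_(N * m)); last exact: continuous_qf.
  by apply: continuous_sumr => k; exact: cell.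
have [r rP] := coer (mpc_cost x (fun=> 0)).
(* The absolute value keeps [0] in the box whatever the sign of [r]. *)
pose box := [set U : 'rV[R]_(N * m) | forall i, `[- `|r|, `|r| ]%classic (U 0 i)]%classic.
have box0 : box 0.
  by move=> i /=; rewrite mxE in_itv/= oppr_le0 !normr_ge0.
have cbox : compact box.
  apply: (@rV_compact R _ (fun=> `[- `|r|, `|r| ]%classic)) => i.
  exact: segment_compact.
have [c cb cmin] := compact_EVT_min (ex_intro _ 0 box0) cbox
  (continuous_subspaceT cJ).
exists (dec c) => v.
have dec0 : mpc_cost x (dec 0) = mpc_cost x (fun=> 0).
  apply: mpc_cost_ext => k kN; rewrite /dec; case: insubP => // i _ _.
  by apply/matrixP => a b; rewrite !mxE.
case: (leP (mpc_cost x v) (mpc_cost x (fun=> 0))) => [le0|lt0]; last first.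
  by apply: le_trans (ltW lt0); rewrite -dec0; apply: cmin; exact: mem_set.
pose U := mxvec (\matrix_(i < N) (v i)^T).
have decU k : (k < N)%N -> dec U k = v k.
  move=> kN; rewrite /dec /U insubT mxvecK rowK trmxK//.
rewrite -(mpc_cost_ext x decU); apply: cmin; apply: mem_set => i /=.
case/mxvec_indexP: i => k j.
have kb : nrm (v k) <= r.
  by apply: rP (pstate A B v x k) _ _; apply: le_trans le0; exact: ell_le_cost.
rewrite mxvecE !mxE in_itv/= -ler_norml.
by apply: le_trans (ler_norm r); apply: le_trans kb; exact: coord_le_nrm.
Qed.

End Cost.

(** * Vanishing sequences *)

Section VanishingSequences.
Local Open Scope classical_set_scope.
Local Open Scope ring_scope.
Variable R : realType.
Implicit Types f g : nat -> R.

Lemma cvg0_le f g (C : R) : (forall k, 0 <= f k <= C * g k) ->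
  g @ \oo --> 0 -> f @ \oo --> 0.
Proof.
move=> fg cg; apply: (@squeeze_cvgr _ _ _ _ (fun=> 0) (fun k => C * g k)).
- by apply: nearW => k; exact: fg.
- exact: cvg_cst.
- suff : C * g k @[k --> \oo] --> C * 0 by rewrite mulr0.
  by apply: cvgM => //; exact: cvg_cst.
Qed.

(** Here [g] is nondecreasing and bounded, hence convergent, so its increments vanish. *)
Lemma cvg0_increment f g (M : R) :
  (forall k, 0 <= f k <= g k.+1 - g k) -> (forall k, g k <= M) -> f @ \oo --> 0.
Proof.
move=> fg gM.
have cg : cvgn g.
  apply: nondecreasing_is_cvgn; last by exists M => _ [k _ <-].
  by apply/nondecreasing_seqP => k; have /andP[/le_trans h /h] := fg k; rewrite subr_ge0.
apply: (@squeeze_cvgr _ _ _ _ (fun=> 0) (fun k => g k.+1 - g k)).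
- by apply: nearW => k; exact: fg.
- exact: cvg_cst.
- suff : g k.+1 - g k @[k --> \oo] --> limn g - limn g by rewrite subrr.
  by apply: cvgB => //; rewrite (cvg_shiftS g).
Qed.

Lemma cvg0_sqrt f : f @ \oo --> 0 -> Num.sqrt (f k) @[k --> \oo] --> 0.
Proof.
move=> cf; rewrite -[X in _ --> X]sqrtr0.
by apply: (@cvg_comp _ _ _ f Num.sqrt); [exact: cf|exact: sqrt_continuous].
Qed.

Lemma cvg0_converges n (s : nat -> 'cV[R]_n) :
  nrm (s k) @[k --> \oo] --> 0 -> converges_to_zero s.
Proof.
move=> /cvgr0Pnorm_lt cs e /cs [K _ KP]; exists K => k Kk.
apply: le_lt_trans (enorm_le_nrm _) _; apply: le_lt_trans (ler_norm _) _.
exact: KP.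
Qed.

Lemma converges_cvg0 n (s : nat -> 'cV[R]_n) :
  converges_to_zero s -> nrm (s k) @[k --> \oo] --> 0.
Proof.
move=> cs; apply/cvgr0Pnorm_lt => e e0.
have [|K KP] := cs (e / (n%:R + 1)); first by rewrite divr_gt0// ltr_wpDl.
exists K => // k Kk /=; rewrite ger0_norm ?nrm_ge0//.
apply: le_lt_trans (nrm_le_enorm _) _.
apply: (@le_lt_trans _ _ ((n%:R + 1) * enorm (s k))).
  by rewrite ler_wpM2r ?sqrtr_ge0// lerDl.
by rewrite mulrC -ltr_pdivlMr ?ltr_wpDl//; exact: KP.
Qed.

(** The sum is the entrywise l1 norm of [L ^+ k]: stability on basis vectors gives decay uniform in
    the vector. *)
Lemma cvg0_columns n (L : 'M[R]_n) :
  (forall x : 'cV[R]_n, converges_to_zero (fun k => L ^+ k *m x)) ->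
  \sum_(i < n) nrm (L ^+ k *m delta_mx i 0) @[k --> \oo] --> 0.
Proof.
move=> stabL.
rewrite [X in _ --> X](_ : 0 = \sum_(i < n) (0 : R)); last by rewrite big1.
apply: cvg_big => [|i _]; first exact: add_continuous.
exact: converges_cvg0.
Qed.

(* A bounded sequence driven backwards in time by a Schur stable matrix and a
   vanishing perturbation vanishes: expand far enough ahead for the power of
   the matrix to absorb the bound. *)
Lemma backward_stable n (L : 'M[R]_n) (p : nat -> 'cV[R]_n) (M : R) :
  (forall x : 'cV[R]_n, converges_to_zero (fun k => L ^+ k *m x)) ->
  (forall k, nrm (p k) <= M) ->
  nrm (p k - L *m p k.+1) @[k --> \oo] --> 0 ->
  nrm (p k) @[k --> \oo] --> 0.
Proof.
move=> stabL pM cr.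
have M0 : 0 <= M by apply: le_trans (pM 0%N); exact: nrm_ge0.
have step j : nrm (p k - L ^+ j *m p (k + j)%N) @[k --> \oo] --> 0.
  elim: j => [|j IH].
    apply: (@cvg0_le _ (fun k => nrm (p k - L *m p k.+1)) 0) => // k.
    rewrite nrm_ge0 mul0r expr0 addn0 mul1mx subrr /nrm big1 ?lexx// => i _.
    by rewrite mxE normr0.
  have [C C0 CP] := nrm_mul (L ^+ j).
  apply: (@cvg0_le _ (fun k => nrm (p k - L ^+ j *m p (k + j)%N)
    + C * nrm (p (k + j)%N - L *m p (k + j).+1)) 1) => [k|].
    rewrite nrm_ge0 mul1r /=.
    have -> : p k - L ^+ j.+1 *m p (k + j.+1)%N
        = (p k - L ^+ j *m p (k + j)%N)
          + L ^+ j *m (p (k + j)%N - L *m p (k + j).+1).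
      by rewrite addnS exprSr mulmxBr mulmxA addrA subrK.
    by apply: le_trans (nrmD _ _) _; rewrite lerD2l CP.
  rewrite -[X in _ --> X]addr0; apply: cvgD; first exact: IH.
  rewrite -[X in _ --> X](mulr0 C); apply: cvgM; first exact: cvg_cst.
  by rewrite (cvg_shiftn j (fun k => nrm (p k - L *m p k.+1))).
have powL e : 0 < e -> exists j, forall y, nrm (L ^+ j *m y) <= e * nrm y.
  move=> e0.
  have /cvgr0Pnorm_lt/(_ e e0)[j _ /(_ j (leqnn j))/=] := cvg0_columns stabL.
  rewrite ger0_norm ?sumr_ge0// => [Sj|i _]; last exact: nrm_ge0.
  exists j => y; apply: le_trans (ler_wpM2r (nrm_ge0 y) (ltW Sj)).
  have {1}-> : y = \sum_i y i 0 *: delta_mx i 0.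
    apply/matrixP => a b; rewrite ord1 summxE (bigD1 a)//= big1 => [|i ia].
      by rewrite !mxE !eqxx mulr1 addr0.
    by rewrite !mxE eq_sym (negPf ia) mulr0.
  rewrite mulmx_sumr mulr_suml.
  elim/big_ind2 : _ => [|a b c d ab cd|i _].
  - by rewrite /nrm big1// => i _; rewrite mxE normr0.
  - by apply: le_trans (nrmD _ _) _; rewrite lerD.
  - rewrite -scalemxAr {1}/nrm.
    under eq_bigr do rewrite mxE normrM.
    by rewrite -mulr_sumr mulrC ler_wpM2l ?nrm_ge0 ?coord_le_nrm.
apply/cvgr0Pnorm_lt => e e0.
(* First [j] is fixed so that [L ^+ j] shrinks the bound [M] to at most [e / 2], then [k] is taken
   large for that [j]; [M + 1] guards against [M = 0]. *)
have [|j jP] := powL (e / 2 / (M + 1)); first by rewrite !divr_gt0// ltr_wpDl.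
have /cvgr0Pnorm_lt/(_ (e / 2))[|K _ KP] := step j; first by rewrite divr_gt0.
exists K => // k /KP /=; rewrite !ger0_norm ?nrm_ge0// => pk.
have -> : p k = (p k - L ^+ j *m p (k + j)%N) + L ^+ j *m p (k + j)%N.
  by rewrite subrK.
apply: le_lt_trans (nrmD _ _) _; rewrite [ltRHS]splitr ltr_leD//.
apply: le_trans (jP _) _; rewrite mulrAC ler_pdivrMr ?ltr_wpDl//.
rewrite ler_wpM2l//; first by rewrite divr_ge0// ltW.
by apply: le_trans (pM _) _; rewrite lerDl.
Qed.

Lemma trmx_exp n (L : 'M[R]_n) k : (L ^+ k)^T = L^T ^+ k.
Proof.
elim: k => [|k IH]; first by rewrite !expr0 trmx1.
by rewrite exprS exprSr -IH; exact: trmx_mul.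
Qed.

(** Transposition permutes the entries of [L ^+ k], and [cvg0_columns] bounds all of them. *)
Lemma converges_to_zero_tr n (L : 'M[R]_n) :
  (forall x : 'cV[R]_n, converges_to_zero (fun k => L ^+ k *m x)) ->
  forall x : 'cV[R]_n, converges_to_zero (fun k => L^T ^+ k *m x).
Proof.
move=> stabL x; apply: cvg0_converges.
apply: (cvg0_le (C := nrm x) _ (cvg0_columns stabL)) => k; rewrite nrm_ge0 /=.
have -> : nrm (L^T ^+ k *m x)
    = \sum_(i < n) `| \sum_l (L ^+ k *m (delta_mx i 0 : 'cV[R]_n)) l 0 * x l 0|.
  apply: eq_bigr => i _; rewrite -trmx_exp mxE; congr (`|_|).
  by apply: eq_bigr => l _; rewrite -colE !mxE.
rewrite mulr_sumr; apply: ler_sum => i _.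
apply: le_trans (ler_norm_sum _ _ _) _; rewrite {1}/nrm mulr_suml.
apply: ler_sum => l _; rewrite normrM mulrC.
by apply: ler_wpM2l => //; exact: coord_le_nrm.
Qed.

End VanishingSequences.

(** * Closed-loop stability *)

Section Stability.
Local Open Scope classical_set_scope.
Local Open Scope ring_scope.
Variables (R : realType) (n m : nat) (A : 'M[R]_n) (B : 'M[R]_(n, m)).
Variables (P W : 'M[R]_n) (Rt : 'M[R]_m) (K : 'M[R]_(m, n)) (N : nat).
Variables (ell : 'cV[R]_n -> 'cV[R]_m -> R) (c : R).
Let S := Rt + B^T *m P *m B.
Let AK := A + B *m K.
Hypotheses (pdP : pd P) (pdRt : pd Rt) (psdW : psd W) (N_gt0 : (0 < N)%N).
Hypothesis stab : stabilizable A B.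
Hypothesis defK : K = - (invmx S *m B^T *m P *m A).
Hypothesis defP : P = AK^T *m P *m AK + K^T *m Rt *m K + W.
Hypothesis c_ge0 : 0 <= c.
Hypothesis ell_ge0 : forall x u, 0 <= ell x u.
Hypothesis ell_input : forall x u, qf Rt u <= c * ell x u.
Hypothesis ell_state : forall x u, qf W x <= c * (ell x u + ell x u ^+ 2).
Hypothesis ell_terminal : forall x, ell x (K *m x) + qf P (AK *m x) <= qf P x.

Local Notation J := (mpc_cost A B P ell N).
Let psdP := pd_psd pdP.

(** A common gauge: [ell_state] bounds [W x] only through [s + s^2], and [G] also dominates the
    [sqrt s] that bounds the input. *)
Let G (s : R) := Num.sqrt (s + s ^+ 2).

Let G_ge0 s : 0 <= G s. Proof. exact: sqrtr_ge0. Qed.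

Let ler_G s t : 0 <= s -> s <= t -> G s <= G t.
Proof. by move=> s0 st; apply: ler_wsqrtr; nra. Qed.

Let sqrt_le_G s : Num.sqrt s <= G s.
Proof. by apply: ler_wsqrtr; rewrite lerDl sqr_ge0. Qed.

Lemma nrm_input : exists2 C, 0 <= C &
  forall x u, nrm u <= C * Num.sqrt (ell x u).
Proof.
have [C C0 CP] := pd_nrm pdRt; exists (C * Num.sqrt c) => [|x u].
  by rewrite mulr_ge0 ?sqrtr_ge0.
by apply: le_trans (CP u) _; rewrite -mulrA -sqrtrM// ler_wpM2l ?ler_wsqrtr.
Qed.

(* [P x = AK^T P A x + W x] bounds the state by its successor, although [ell]
   itself need not control [x]. *)
Lemma nrm_state_step : exists2 C, 0 <= C & forall x u s, ell x u <= s ->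
  nrm x <= C * (nrm (A *m x + B *m u) + G s).
Proof.
have [c1 c10 c1P] := nrm_mul (invmx P).
have [c2 c20 c2P] := nrm_mul (AK^T *m P).
have [c3 c30 c3P] := nrm_mul B.
have [c4 c40 c4P] := psd_nrm psdW.
have [c5 c50 c5P] := nrm_input.
have d0 : 0 <= c2 * c3 * c5 + c4 * Num.sqrt c.
  by rewrite addr_ge0 ?mulr_ge0 ?sqrtr_ge0.
exists (c1 * (c2 + (c2 * c3 * c5 + c4 * Num.sqrt c))) => [|x u s ells].
  by rewrite mulr_ge0// addr_ge0.
have sG : G (ell x u) <= G s by exact: ler_G.
have uG : nrm u <= c5 * G s.
  apply: le_trans (c5P x u) _; rewrite ler_wpM2l//.
  exact: le_trans (sqrt_le_G _) sG.
have WG : nrm (W *m x) <= c4 * Num.sqrt c * G s.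
  apply: le_trans (c4P x) _; rewrite -mulrA ler_wpM2l//.
  apply: (@le_trans _ _ (Num.sqrt c * G (ell x u))); last by rewrite ler_wpM2l ?sqrtr_ge0.
  by rewrite -sqrtrM// ler_wsqrtr.
rewrite -{1}(mulKmx (pd_unitmx pdP) x); apply: le_trans (c1P _) _.
rewrite -mulrA ler_wpM2l//.
(* Writing [A x] as the successor minus [B u] leaves only quantities already bounded. *)
have -> : P *m x = AK^T *m P *m ((A *m x + B *m u) + - (B *m u)) + W *m x.
  by rewrite addrK {1}(riccati_short_tr pdP pdRt defK defP (proj1 psdW)) mulmxDl mulmxA.
apply: le_trans (nrmD _ _) _.
have Bu : nrm (- (B *m u)) <= c3 * (c5 * G s).
  by rewrite nrmN; apply: le_trans (c3P u) _; rewrite ler_wpM2l.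
have := c2P (A *m x + B *m u + - (B *m u)).
have := ler_wpM2l c20 (le_trans (nrmD (A *m x + B *m u) (- (B *m u))) (lerD (lexx _) Bu)).
move: WG; set y := nrm (A *m x + B *m u).
have y0 : 0 <= y by exact: nrm_ge0.
have := mulr_ge0 c20 (G_ge0 s); have := mulr_ge0 d0 y0.
set a := nrm (W *m x); set b := nrm (_ *m _).
lra.
Qed.

Lemma nrm_state_horizon j : exists2 C, 0 <= C & forall x u s,
  (forall k, (k < j)%N -> ell (pstate A B u x k) (u k) <= s) ->
  nrm x <= C * (nrm (pstate A B u x j) + G s).
Proof.
have [C C0 CP] := nrm_state_step.
elim: j => [|j [D D0 IH]]; first by exists 1 => // x u s _; rewrite mul1r lerDl.
exists (D * (C + 1)) => [|x u s us]; first by rewrite mulr_ge0// addr_ge0.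
apply: le_trans (IH x u s _) _; first by move=> k kj; apply: us; exact: ltnW.
rewrite -mulrA ler_wpM2l// mulrDl mul1r.
have := nrm_ge0 (pstate A B u x j.+1); have := CP _ _ _ (us j (ltnSn j)).
by rewrite -[pstate A B u x j.+1]/(A *m pstate A B u x j + B *m u j); lra.
Qed.

(** The positive definite terminal term bounds the last state, and [nrm_state_horizon] carries this
    bound back to [x]. *)
Lemma nrm_le_cost : exists2 C, 0 <= C & forall x u, nrm x <= C * G (J x u).
Proof.
have [C C0 CP] := nrm_state_horizon N; have [D D0 DP] := pd_nrm pdP.
exists (C * (D + 1)) => [|x u]; first by rewrite mulr_ge0// addr_ge0.
apply: le_trans (CP x u (J x u) _) _.
  by move=> k kN; apply: ell_le_cost.
rewrite -mulrA ler_wpM2l// mulrDl mul1r lerD2r; apply: le_trans (DP _) _.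
rewrite ler_wpM2l//; apply: le_trans (sqrt_le_G _); apply: ler_wsqrtr.
exact: terminal_le_cost.
Qed.

(** Along the linear feedback [K] the stage costs telescope by [ell_terminal]. *)
Lemma cost_upper x : exists u, J x u <= qf P x.
Proof.
pose y k := iter k (fun z => AK *m z) x; pose u k := K *m y k.
have yE k : pstate A B u x k = y k.
  elim: k => //= k ->; rewrite /u -/(y k) /AK mulmxDl mulmxA//.
exists u; rewrite /mpc_cost yE; under eq_bigr do rewrite yE.
elim: (N) => [|j IH]; first by rewrite big_ord0 add0r.
rewrite big_ord_recr/=; have := ell_terminal (y j).
by rewrite -/(y j) /u; lra.
Qed.

Lemma cost_descent x u : exists v,
  J (A *m x + B *m u 0%N) v <= J x u - ell x (u 0%N).
Proof.
case: N N_gt0 => // N' _.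
(* The horizon is [N'.+1], so [N'] indexes the last input, applied at the old terminal state. *)
pose v k := if k == N' then K *m pstate A B u x N'.+1 else u k.+1.
have v_lt k : (k < N')%N -> v k = u k.+1 by move=> kN; rewrite /v ltn_eqF.
have vE k : (k <= N')%N ->
    pstate A B v (A *m x + B *m u 0%N) k = pstate A B u x k.+1.
  by elim: k => //= k IH kN; rewrite IH ?(ltnW kN)// v_lt.
exists v; rewrite /mpc_cost big_ord_recr [in leRHS]big_ord_recl /= vE//.
have -> : v N' = K *m pstate A B u x N'.+1 by rewrite /v eqxx.
have -> : \sum_(i < N') ell (pstate A B v (A *m x + B *m u 0%N) i) (v i)
    = \sum_(i < N') ell (pstate A B u x (bump 0 i)) (u (bump 0 i)).
  by apply: eq_bigr => i _; rewrite vE ?v_lt// ltnW.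
have := ell_terminal (pstate A B u x N'.+1).
by rewrite /AK mulmxDl mulmxA /=; lra.
Qed.

Variable kappa : 'cV[R]_n -> 'cV[R]_m.
Hypothesis kappa_opt : forall x, exists u,
  (forall v, J x u <= J x v) /\ u 0%N = kappa x.

(** Collects all that the stability proof uses of optimality. The bound by [qf P] stands in for
    continuity of [V] at the origin. *)
Lemma optimal_value : exists V : 'cV[R]_n -> R,
  [/\ forall x, 0 <= V x,
      forall x, V x <= qf P x,
      exists2 C, 0 <= C & forall x, nrm x <= C * G (V x) &
      forall x, V (A *m x + B *m kappa x) <= V x - ell x (kappa x)].
Proof.
have [U UP] := choice kappa_opt.
exists (fun x => J x (U x)); split.
- by move=> x; exact: mpc_cost_ge0.
- by move=> x; have [u /(le_trans _)] := cost_upper x; apply; have [] := UP x.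
- by have [C C0 CP] := nrm_le_cost; exists C.
- move=> x; have [opt <-] := UP x; have [v] := cost_descent x (U x).
  by apply: le_trans; have [] := UP (A *m x + B *m U x 0%N).
Qed.

Lemma closed_loop_GAS : GAS (closed_loop A B kappa).
Proof.
have [V [V0 Vle [C C0 CP] Vdec]] := optimal_value.
have clS x0 k : closed_loop A B kappa x0 k.+1
    = A *m closed_loop A B kappa x0 k + B *m kappa (closed_loop A B kappa x0 k).
  by [].
have Vmono x0 k : V (closed_loop A B kappa x0 k) <= V x0.
  elim: k => // k IH; rewrite clS; apply: le_trans (Vdec _) (le_trans _ IH).
  by rewrite gerBl.
have [D D0 DP] := qf_le_nrm P.
split=> [e e0|x0].
  (* Here [C * a < e]; below, [v <= 1] and [2 v <= a^2] give [G v <= a], and [d <= 1] lets the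
     square of the initial norm be bounded by the norm itself. *)
  pose a := e / (C + 1); have C1 : 0 < C + 1 by rewrite ltr_wpDl.
  have a0 : 0 < a by rewrite divr_gt0.
  pose v := Num.min 1 (a ^+ 2 / 2).
  have v0 : 0 < v by rewrite lt_min ltr01 divr_gt0 ?exprn_gt0.
  have v1 : v <= 1 by rewrite ge_min lexx.
  have va : v <= a ^+ 2 / 2 by rewrite ge_min lexx orbT.
  pose b := D * n%:R ^+ 2.
  have b0 : 0 <= b by rewrite mulr_ge0 ?sqr_ge0.
  have b1 : 0 < b + 1 by rewrite ltr_wpDl.
  pose d := Num.min 1 (v / (b + 1)).
  exists d; split; first by rewrite lt_min ltr01 divr_gt0.
  move=> x0 x0d k; apply: le_lt_trans (enorm_le_nrm _) _.
  apply: le_lt_trans (CP _) _.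
  have Vv : V x0 <= v.
    have e_ge0 : 0 <= enorm x0 by exact: sqrtr_ge0.
    have ed1 : enorm x0 <= 1.
      by apply: le_trans (ltW x0d) _; rewrite ge_min lexx.
    have ed2 : (b + 1) * enorm x0 <= v.
      rewrite mulrC -ler_pdivlMr//; apply: le_trans (ltW x0d) _.
      by rewrite ge_min lexx orbT.
    apply: le_trans (Vle _) _; apply: le_trans (DP _) _.
    apply: (@le_trans _ _ (b * enorm x0 ^+ 2)).
      rewrite /b -mulrA -exprMn ler_wpM2l// ler_pXn2r ?nnegrE ?nrm_ge0 ?mulr_ge0//.
      exact: nrm_le_enorm.
    by nra.
  have Ga : G (V (closed_loop A B kappa x0 k)) <= a.
    apply: le_trans (ler_G (V0 _) (le_trans (Vmono x0 k) Vv)) _.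
    rewrite -(ger0_norm (ltW a0)) -sqrtr_sqr; apply: ler_wsqrtr.
    by nra.
  apply: (@le_lt_trans _ _ (C * a)); first by rewrite ler_wpM2l.
  by rewrite /a mulrCA gtr_pMr// ltr_pdivrMr// mul1r ltrDl.
pose x k := closed_loop A B kappa x0 k; pose u k := kappa (x k).
pose s k := ell (x k) (u k); pose v := V x0.
pose e k := u k - K *m x k.
have xS k : x k.+1 = A *m x k + B *m u k by [].
have Vv k : V (x k) <= v by exact: Vmono.
have s0 k : 0 <= s k by exact: ell_ge0.
have sdec k : s k <= V (x k) - V (x k.+1).
  by have := Vdec (x k); rewrite xS /s; lra.
have sv k : s k <= v by have := sdec k; have := Vv k; have := V0 (x k.+1); lra.
have ss k : s k + s k ^+ 2 <= (1 + v) * s k.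
  by have := s0 k; have := sv k; nra.
have xb k : nrm (x k) <= C * G v.
  by apply: le_trans (CP _) _; rewrite ler_wpM2l ?ler_G.
have pdS := riccati_pd B pdP pdRt.
have Sge0 y : 0 <= qf S y by have [_] := pd_psd pdS.
(* The drop of [q * V] pays [c * s k] for the input, [c * (1 + v) * s k] for [W], and the summand
   [s k] of [t k]; hence [t k] is at most the increment of [Phi]. *)
pose q := c * (2 + v) + 1.
pose t k := qf S (e k) + s k.
pose Phi k := qf P (x k) - q * V (x k).
have v_ge0 : 0 <= v by exact: V0.
have q0 : 0 <= q by rewrite addr_ge0// mulr_ge0// addr_ge0.
have ct : t @ \oo --> 0.
  apply: (@cvg0_increment _ _ Phi (D * (C * G v) ^+ 2)) => k.
    apply/andP; split; first by rewrite addr_ge0.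
    have := riccati_identity pdP pdRt defK defP (x k) (u k).
    rewrite -/S -/(e k) -xS /t /Phi.
    have := ell_input (x k) (u k); have := ell_state (x k) (u k).
    rewrite -/(s k) => hW hR hS.
    have hs := ler_wpM2l c_ge0 (ss k).
    have hq := ler_wpM2l q0 (sdec k).
    by move: hq; rewrite /q; lra.
  apply: (@le_trans _ _ (qf P (x k))); first by rewrite gerBl mulr_ge0.
  apply: le_trans (DP _) _; rewrite ler_wpM2l// ler_pXn2r ?nnegrE ?nrm_ge0//.
  by rewrite mulr_ge0.
have [F Fstab] := stab.
pose L := (A + B *m F)^T.
have Lstab : forall y : 'cV[R]_n, converges_to_zero (fun k => L ^+ k *m y).
  apply: converges_to_zero_tr => y a /(Fstab y)[j jP]; exists j => k /jP.
  suff -> : iter k (fun z => (A + B *m F) *m z) y = (A + B *m F) ^+ k *m y by [].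
  elim: k => [|k IH]; first by rewrite expr0 mul1mx.
  by rewrite iterS IH exprS mulmxA.
(* Combines [A^T P AK = P - W] with [F^T B^T P AK = - F^T Rt K]. *)
have LP : L *m P *m AK = P - W - F^T *m (Rt *m K).
  have -> : L = A^T + F^T *m B^T by rewrite [LHS]linearD/= trmx_mul.
  rewrite !mulmxDl -!mulmxA (mulmxA B^T) (riccati_gain pdP pdRt defK) -/AK.
  rewrite mulmxN; congr (_ - _).
  by rewrite {2}(riccati_short pdP pdRt defK defP) addrK mulmxA.
have [c1 c10 c1P] := psd_nrm psdW.
have [c2 c20 c2P] := nrm_mul (F^T *m Rt).
have [c3 c30 c3P] := nrm_mul (L *m P *m B).
have [c4 c40 c4P] := pd_nrm pdS.
have [c5 c50 c5P] := nrm_input.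
(* Since [K x = u - e], the residual involves only [W x], [u] and [e], each of order
   [sqrt (t k)]. *)
have rE k : P *m x k - L *m (P *m x k.+1)
    = W *m x k + (F^T *m Rt *m (u k + - e k) + - (L *m P *m B *m e k)).
  have -> : x k.+1 = AK *m x k + B *m e k.
    by rewrite xS /AK /e mulmxBr mulmxDl !mulmxA addrACA subrr addr0 addrC.
  have -> : u k + - e k = K *m x k by rewrite /e opprB addrC subrK.
  have -> : L *m (P *m (AK *m x k + B *m e k)) = P *m x k - W *m x k
      - F^T *m Rt *m (K *m x k) + L *m P *m B *m e k.
    by rewrite !mulmxDr !mulmxA LP !mulmxBl !mulmxA.
  by rewrite !opprD !opprK !addrA subrr add0r.
pose c6 := c1 * Num.sqrt (c * (1 + v)) + c2 * (c5 + c4) + c3 * c4.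
have cr : nrm (P *m x k - L *m (P *m x k.+1)) @[k --> \oo] --> 0.
  apply: (cvg0_le (C := c6) _ (cvg0_sqrt ct)) => k; rewrite nrm_ge0/= rE.
  have st : Num.sqrt (s k) <= Num.sqrt (t k) by rewrite ler_wsqrtr// lerDr.
  have hu : nrm (u k) <= c5 * Num.sqrt (t k).
    by apply: le_trans (c5P (x k) (u k)) _; rewrite ler_wpM2l.
  have he : nrm (e k) <= c4 * Num.sqrt (t k).
    by apply: le_trans (c4P (e k)) _; rewrite ler_wpM2l// ler_wsqrtr// lerDl.
  have hW : nrm (W *m x k) <= c1 * Num.sqrt (c * (1 + v)) * Num.sqrt (t k).
    apply: le_trans (c1P _) _; rewrite -mulrA ler_wpM2l//.
    rewrite -sqrtrM ?mulr_ge0 ?addr_ge0// ler_wsqrtr//.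
    apply: le_trans (ell_state (x k) (u k)) _; rewrite -mulrA ler_wpM2l//.
    apply: le_trans (ss k) _; rewrite ler_wpM2l ?addr_ge0//.
    by rewrite /t lerDr.
  rewrite /c6 2!mulrDl -addrA; apply: le_trans (nrmD _ _) _; apply: lerD => //.
  apply: le_trans (nrmD _ _) _; rewrite nrmN; apply: lerD.
    apply: le_trans (c2P _) _; rewrite -mulrA ler_wpM2l// mulrDl.
    by apply: le_trans (nrmD _ _) _; rewrite nrmN lerD.
  by apply: le_trans (c3P _) _; rewrite -mulrA ler_wpM2l.
have [c7 c70 c7P] := nrm_mul P.
have cp : nrm (P *m x k) @[k --> \oo] --> 0.
  apply: (@backward_stable _ _ L (fun k => P *m x k) (c7 * (C * G v))) => // k.
  by apply: le_trans (c7P _) _; rewrite ler_wpM2l.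
have [c8 c80 c8P] := nrm_mul (invmx P).
apply: cvg0_converges; apply: (cvg0_le (C := c8) _ cp) => k; rewrite nrm_ge0/=.
by rewrite -{1}(mulKmx (pd_unitmx pdP) (closed_loop _ _ _ _ _)).
Qed.

End Stability.

(** * Application to the relaxed barrier cost *)

Theorem theorem5 (R : realType) (n m px pu : nat)
  (A : 'M[R]_n) (B : 'M[R]_(n, m))
  (Cx : 'M[R]_(px, n)) (dx : 'cV[R]_px) (Cu : 'M[R]_(pu, m)) (du : 'cV[R]_pu)
  (Q : 'M[R]_n) (Rm : 'M[R]_m) (N : nat) (eps : R)
  (gx gu : bool) (wx : 'cV[R]_px) (wu : 'cV[R]_pu)
  (K : 'M[R]_(m, n)) (P : 'M[R]_n) :
  stabilizable A B ->
  (forall i, 0 < dx i 0) -> (forall i, 0 < du i 0) ->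
  (* U = {u : Cu u <= du} is compact, i.e. bounded *)
  (exists M : R, forall u : 'cV[R]_m, leV (Cu *m u) du -> forall j, `|u j 0| <= M) ->
  psd Q -> pd Rm -> (1 <= N)%N -> 0 < eps ->
  recentering_ok gx Cx dx wx -> recentering_ok gu Cu du wu ->
  pd P ->
  forall delta : R, 0 < delta ->
  admissible (barrier gx Cx dx wx delta) -> admissible (barrier gu Cu du wu delta) ->
  (* modified Riccati equation *)
  let Mx := Mmat delta Cx wx in
  let Mu := Mmat delta Cu wu in
  K = - (invmx (Rm + B^T *m P *m B + eps *: Mu) *m B^T *m P *m A) ->
  P = (A + B *m K)^T *m P *m (A + B *m K) + K^T *m (Rm + eps *: Mu) *m K + Q + eps *: Mx ->
  (* relaxed stage cost and MPC cost *)
  let ellhat := fun (x : 'cV[R]_n) (u : 'cV[R]_m) =>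
      qf Q x + qf Rm u + eps * barrier gu Cu du wu delta u
      + eps * barrier gx Cx dx wx delta x in
  let J := fun (x : 'cV[R]_n) (u : nat -> 'cV[R]_m) =>
      \sum_(k < N) ellhat (pstate A B u x k) (u k) + qf P (pstate A B u x N) in
  let optimal := fun x u => forall v : nat -> 'cV[R]_m, J x u <= J x v in
  (* the relaxed MPC problem has an optimal solution for every x, and *)
  (forall x, exists u, optimal x u) /\
  (* every feedback u(k) = \hat u_0^*(x(k)) renders the origin GAS *)
  (forall kappa : 'cV[R]_n -> 'cV[R]_m,
     (forall x, exists u, optimal x u /\ u 0%N = kappa x) ->
     GAS (closed_loop A B kappa)).
Proof.
move=> stab _ _ _ psdQ pdR N_gt0 eps0 recx recu pdP delta delta0 admx admu Mx Mu.
move=> defK defP ell J opt.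
pose W := Q + eps *: Mx; pose Rt := Rm + eps *: Mu.
have eps_ge0 := ltW eps0.
have psdMu : psd Mu := psd_Mmat delta0 recu.
have psdW : psd W by apply: psdD => //; apply: psdZ => //; exact: psd_Mmat recx.
have pdRt : pd Rt by apply: pdD_psd => //; exact: psdZ.
have defK' : K = - (invmx (Rt + B^T *m P *m B) *m B^T *m P *m A).
  by rewrite /Rt addrAC.
have defP' : P = (A + B *m K)^T *m P *m (A + B *m K) + K^T *m Rt *m K + W.
  by rewrite /W addrA.
set bx := barrier gx Cx dx wx delta in admx ell J opt *.
set bu := barrier gu Cu du wu delta in admu ell J opt *.
have bx0 x : 0 <= bx x by exact: barrier_ge0.
have bu0 u : 0 <= bu u by exact: barrier_ge0.
have Q0 x : 0 <= qf Q x by have [_] := psdQ.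
have R0 u : 0 <= qf Rm u by have [_] := pd_psd pdR.
have ellE x u : ell x u = qf Q x + qf Rm u + eps * bu u + eps * bx x by [].
have ell_ge0 x u : 0 <= ell x u by rewrite ellE !addr_ge0// mulr_ge0.
have [kx kx0 kxP] := qf_le_barrier delta0 recx admx.
have [D D0 DP] := qf_le_nrm Mu; have [C C0 CP] := pd_nrm pdR.
(* [c1] comes from [qf Mu u <= D * C^2 * qf Rm u]. In [c2], the term [kx / eps] appears when
   [eps * bx^2] is written as [(eps * bx)^2 / eps]. *)
pose c1 := 1 + eps * (D * C ^+ 2); pose c2 := 1 + kx + kx / eps.
have c10 : 0 <= c1 by rewrite addr_ge0// !mulr_ge0// sqr_ge0.
have c20 : 0 <= c2 by rewrite !addr_ge0// divr_ge0.
have c0 : 0 <= c1 + c2 by rewrite addr_ge0.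
have ell_input x u : qf Rt u <= (c1 + c2) * ell x u.
  have Rs : qf Rm u <= ell x u.
    by rewrite ellE; have := Q0 x; have := bx0 x; have := bu0 u; nra.
  apply: (@le_trans _ _ (c1 * qf Rm u)); last first.
    apply: (@le_trans _ _ (c1 * ell x u)); first by rewrite ler_wpM2l.
    by rewrite ler_wpM2r// lerDl.
  rewrite /Rt qfDl qfZl /c1 mulrDl mul1r lerD2l -mulrA ler_wpM2l//.
  apply: le_trans (DP u) _; rewrite -mulrA ler_wpM2l//.
  rewrite -[X in _ * X](sqr_sqrtr (R0 u)) -exprMn.
  by rewrite ler_pXn2r ?nnegrE ?nrm_ge0 ?mulr_ge0 ?sqrtr_ge0.
have ell_state x u : qf W x <= (c1 + c2) * (ell x u + ell x u ^+ 2).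
  set s := ell x u; have s0 : 0 <= s by exact: ell_ge0.
  have Qs : qf Q x <= s.
    by rewrite /s ellE; have := R0 u; have := bx0 x; have := bu0 u; nra.
  have bs : eps * bx x <= s.
    by rewrite /s ellE; have := R0 u; have := Q0 x; have := bu0 u; nra.
  apply: (@le_trans _ _ (c2 * (s + s ^+ 2))); last first.
    by rewrite ler_wpM2r ?lerDr// addr_ge0 ?sqr_ge0.
  rewrite /W qfDl qfZl.
  have h1 : eps * qf Mx x <= kx * (eps * bx x) + kx / eps * (eps * bx x) ^+ 2.
    have -> : kx * (eps * bx x) + kx / eps * (eps * bx x) ^+ 2
        = eps * (kx * (bx x + bx x ^+ 2)) by field; rewrite gt_eqF.
    by rewrite ler_wpM2l.
  have h2 : kx * (eps * bx x) <= kx * s by rewrite ler_wpM2l.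
  have h3 : kx / eps * (eps * bx x) ^+ 2 <= kx / eps * s ^+ 2.
    by rewrite ler_wpM2l ?divr_ge0// ler_pXn2r ?nnegrE ?mulr_ge0.
  have h4 : 0 <= kx / eps * s by rewrite mulr_ge0 ?divr_ge0.
  have h5 : 0 <= kx * s ^+ 2 by rewrite mulr_ge0 ?sqr_ge0.
  by have := sqr_ge0 s; rewrite /c2; lra.
(* Replacing both barriers by their quadratic upper bounds turns the claim into the Riccati
   equality. *)
have ell_terminal x : ell x (K *m x) + qf P ((A + B *m K) *m x) <= qf P x.
  have -> : qf P x = qf P ((A + B *m K) *m x) + qf Rt (K *m x) + qf W x.
    by rewrite {1}defP' 2!qfDl 2!qf_mul.
  rewrite /Rt /W 2!qfDl 2!qfZl ellE.
  have := ler_wpM2l eps_ge0 (barrier_le_qf delta0 recx admx x).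
  have := ler_wpM2l eps_ge0 (barrier_le_qf delta0 recu admu (K *m x)).
  by rewrite -/bx -/bu -/Mx -/Mu; lra.
split=> [x|kappa kappaP].
  apply: (@mpc_optimal_exists R n m A B P ell N (pd_psd pdP) ell_ge0).
    move=> T f g cf cg.
    apply: continuousD_fun; last first.
      by move=> t; apply: cvgM; [exact: cvg_cst|exact: continuous_barrier].
    apply: continuousD_fun; last first.
      by move=> t; apply: cvgM; [exact: cvg_cst|exact: continuous_barrier].
    by apply: continuousD_fun; exact: continuous_qf.
  move=> s; have [C' C'0 C'P] := nrm_input pdRt c0 ell_input.
  exists (C' * Num.sqrt s) => y u es; apply: le_trans (C'P y u) _.
  by rewrite ler_wpM2l// ler_wsqrtr.
exact: (@closed_loop_GAS R n m A B P W Rt K N ell (c1 + c2)).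
Qed.
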